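(* Let $G=(V,E)$ be the Soccer Ball Graph (SBG). The minimum cardinality of an Identifying Code Set of $G$ is at least ten.
   Context: For a finite undirected simple graph $G=(V,E)$ and $v\in V$, let $N(v)$ be the set of vertices adjacent to $v$ and $N^+(v)=\{v\}\cup N(v)$. A set $V'\subseteq V$ is an Identifying Code Set (ICS) of $G$ if $N^+(v)\cap V'\neq\varnothing$ for every $v\in V$, and $N^+(v)\cap V'\neq N^+(w)\cap V'$ for all $v,w\in V$ with $v\ne w$. A Minimum Identifying Code Set (MICS) is an ICS of smallest cardinality. The Soccer Ball Graph (SBG) has 32 vertices corresponding to the 20 hexagonal and 12 pentagonal faces of a truncated icosahedron, two vertices being adjacent iff the corresponding faces share a boundary edge (90 edges). Explicitly, $V=P\cup H$ with $P=\{P_{1,1}\}\cup\{P_{i,j}: i\in\{3,4\},1\le j\le5\}\cup\{P_{6,1}\}$ and $H=\{H_{i,j}: 2\le i\le 5, 1\le j\le 5\}$. Second indices $j$ (of the vertices with first index $2,\dots,5$) are taken modulo 5 with representatives $1,\dots,5$. The edges are, for all $1\le j\le5$: $\{P_{1,1},H_{2,j}\}$, $\{P_{6,1},H_{5,j}\}$, $\{H_{2,j},H_{2,j+1}\}$, $\{H_{5,j},H_{5,j+1}\}$, $\{H_{3,j},P_{3,j}\}$, $\{P_{3,j},H_{3,j+1}\}$, $\{H_{4,j},P_{4,j+1}\}$, $\{P_{4,j},H_{4,j}\}$, $\{H_{2,j},H_{3,j}\}$, $\{H_{2,j},P_{3,j-1}\}$, $\{H_{2,j},P_{3,j}\}$,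 $\{H_{3,j},P_{4,j}\}$, $\{H_{3,j},H_{4,j-1}\}$, $\{H_{3,j},H_{4,j}\}$, $\{P_{3,j},H_{4,j}\}$, $\{H_{4,j},H_{5,j}\}$, $\{P_{4,j},H_{5,j}\}$, $\{P_{4,j},H_{5,j-1}\}$. *)

(* Defs.v *)
From HB Require Import structures.
From mathcomp Require Import all_boot all_algebra.
Set Implicit Arguments.
Unset Strict Implicit.
Unset Printing Implicit Defensive.

Record sgraph := SGraph {
  vertex :> finType;
  adj : rel vertex;
  adj_sym : symmetric adj;
  adj_irrefl : irreflexive adj }.

Section IdentifyingCode.
Variable G : sgraph.
Implicit Types (v w : G) (S : {set G}).

Definition nbhd v : {set G} := [set w | adj v w].

Definition cl_nbhd v : {set G} := v |: nbhd v.

Definition is_ICS S : Prop :=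
  (forall v, cl_nbhd v :&: S != set0) /\
  (forall v w, v != w -> cl_nbhd v :&: S != cl_nbhd w :&: S).

Definition is_MICS S : Prop :=
  is_ICS S /\ (forall S' : {set G}, is_ICS S' -> #|S| <= #|S'|).

End IdentifyingCode.

(* The second index j = 1, ..., 5 is read as its residue class in 'Z_5, so the
   representative 5 is the element 0 and j + 1, j - 1 are computed mod 5. *)
Inductive sbg_vertex :=
  | P11 | P61
  | P3 of 'Z_5 | P4 of 'Z_5
  | H2 of 'Z_5 | H3 of 'Z_5 | H4 of 'Z_5 | H5 of 'Z_5.

Definition sbg_code (x : sbg_vertex) :
    (unit + unit + ('Z_5 + 'Z_5) + (('Z_5 + 'Z_5) + ('Z_5 + 'Z_5)))%type :=
  match x with
  | P11 => inl (inl (inl tt)) | P61 => inl (inl (inr tt))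
  | P3 j => inl (inr (inl j)) | P4 j => inl (inr (inr j))
  | H2 j => inr (inl (inl j)) | H3 j => inr (inl (inr j))
  | H4 j => inr (inr (inl j)) | H5 j => inr (inr (inr j))
  end.

Definition sbg_decode
    (c : (unit + unit + ('Z_5 + 'Z_5) + (('Z_5 + 'Z_5) + ('Z_5 + 'Z_5)))%type) :=
  match c with
  | inl (inl (inl _)) => P11 | inl (inl (inr _)) => P61
  | inl (inr (inl j)) => P3 j | inl (inr (inr j)) => P4 j
  | inr (inl (inl j)) => H2 j | inr (inl (inr j)) => H3 j
  | inr (inr (inl j)) => H4 j | inr (inr (inr j)) => H5 j
  end.

Lemma sbg_codeK : cancel sbg_code sbg_decode.
Proof. by case. Qed.

HB.instance Definition _ := Finite.copy sbg_vertex (can_type sbg_codeK).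

Definition sbg_edges (j : 'Z_5) : seq (sbg_vertex * sbg_vertex) :=
  [:: (P11, H2 j); (P61, H5 j);
      (H2 j, H2 (j + 1)%R); (H5 j, H5 (j + 1)%R);
      (H3 j, P3 j); (P3 j, H3 (j + 1)%R);
      (H4 j, P4 (j + 1)%R); (P4 j, H4 j);
      (H2 j, H3 j); (H2 j, P3 (j - 1)%R); (H2 j, P3 j);
      (H3 j, P4 j); (H3 j, H4 (j - 1)%R); (H3 j, H4 j);
      (P3 j, H4 j); (H4 j, H5 j);
      (P4 j, H5 j); (P4 j, H5 (j - 1)%R)].

Definition sbg_adj : rel sbg_vertex := fun x y =>
  [exists j, ((x, y) \in sbg_edges j) || ((y, x) \in sbg_edges j)].

Lemma sbg_adj_sym : symmetric sbg_adj.
Proof. by move=> x y; apply: eq_existsb => j; rewrite orbC. Qed.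

Lemma sbg_adj_irrefl : irreflexive sbg_adj.
Proof.
move=> x; apply/existsP => -[j]; rewrite orbb.
by case: j => -[|[|[|[|[|j]]]]] // Hj; case: x => [||k|k|k|k|k|k];
   rewrite ?inE //; case: k => -[|[|[|[|[|k]]]]].
Qed.

Definition SBG : sgraph := SGraph sbg_adj_sym sbg_adj_irrefl.

(* Main.v *)
(* An identifying code meets every closed neighbourhood and every symmetric
   difference of two closed neighbourhoods.  In the soccer ball graph this
   hitting-set problem, even restricted to the symmetric differences of adjacent
   pairs, has no solution with nine vertices: branching on a smallest constraint
   refutes it after about 40000 nodes, which is checked by computation. *)
Require Import Defs.
From mathcomp Require Import all_boot all_algebra.
Set Implicit Arguments.
Unset Strict Implicit.
Unset Printing Implicit Defensive.

Definition hits (T : eqType) (s : seq T) (cs : seq (seq T)) : bool :=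
  all (has (mem s)) cs.

Definition shorter (T : Type) (c d : seq T) : seq T :=
  if size d < size c then d else c.

(* Either the first element [x] of [c] is used, or it is discarded from every
   constraint and the rest of [c] is examined. *)
Fixpoint branch (T : eqType) (refute : seq (seq T) -> bool)
    (c : seq T) (cs : seq (seq T)) : bool :=
  if c is x :: c' then
    refute [seq d <- cs | x \notin d]
    && branch refute c' [seq [seq y <- d | y != x] | d <- cs]
  else true.

(** [k] is the budget of elements still allowed. An empty list of constraints is hit for free, hence
    [false]; a constraint left over at budget 0 is a refutation, hence [true]. Branching on a
    shortest constraint keeps the search tree small; soundness only uses that it is one of the
    constraints. *)
Fixpoint no_hitting (T : eqType) (k : nat) (cs : seq (seq T)) : bool :=
  if cs is c :: cs' then
    if k is k'.+1 then branch (no_hitting k') (foldl (@shorter T) c cs') cs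
    else true
  else false.

Lemma foldl_shorter_mem (T : eqType) (c : seq T) (cs : seq (seq T)) :
  foldl (@shorter T) c cs \in c :: cs.
Proof.
elim: cs c => [|d cs IH] c /=; first exact: mem_head.
have := IH (shorter c d); rewrite /shorter !inE.
by case: ifP => _ /orP[/eqP->|->]; rewrite ?eqxx ?orbT.
Qed.

Lemma no_hitting_size (T : eqType) (k : nat) (cs : seq (seq T)) (s : seq T) :
  no_hitting k cs -> hits s cs -> k < size s.
Proof.
elim: k cs s => [|k IH] [|c0 cs0] s //.
  by case: s => // _ /andP[/hasP[x]].
(* The chosen constraint is consumed element by element while [ds] is pruned, so that [c] is hit
   must be carried as a hypothesis of its own; it excludes [c = [::]]. *)
have branchP c ds : branch (no_hitting k) c ds -> hits s ds -> has (mem s) c -> k.+1 < size s.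
  elim: c ds => [|x c IHc] ds //= /andP[no_x br] hs.
  case: (boolP (x \in s)) => [xs _|xNs /= hc].
    (* Taking [x] out of [s] pays one unit of budget; the constraints kept avoid [x], so the rest of
       [s] still hits them. *)
    rewrite (perm_size (perm_to_rem xs)) ltnS.
    apply: IH no_x _; apply/allP => d; rewrite mem_filter => /andP[xNd d_ds].
    have /hasP[y yd ys] := allP hs d d_ds; apply/hasP; exists y => //.
    move: ys; rewrite /= (perm_mem (perm_to_rem xs)) inE => /orP[/eqP yx|//].
    by rewrite -yx yd in xNd.
  apply: IHc br _ hc; apply/allP => _ /mapP[d d_ds ->].
  have /hasP[y yd ys] := allP hs d d_ds; apply/hasP; exists y => //.
  by rewrite mem_filter yd andbT; apply: contraNneq xNs => <-.
move=> br hs; apply: (branchP _ _ br hs).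
exact: (allP hs) (foldl_shorter_mem _ _).
Qed.

(** Relabelling preserves the size of [s], so a bound proved for the images holds for [s] itself. *)
Lemma hits_map (T U : eqType) (f : T -> U) (s : seq T) (cs : seq (seq T)) :
  hits s cs -> hits (map f s) (map (map f) cs).
Proof.
move/allP=> hs; apply/allP => _ /mapP[c /hs/hasP[x xc xs] ->].
by apply/hasP; exists (f x); apply: map_f.
Qed.

Definition residues5 : seq 'Z_5 := [:: 0; 1; 2%:R; 3%:R; 4%:R]%R.

Lemma mem_residues5 (j : 'Z_5) : j \in residues5.
Proof. by case: j => -[|[|[|[|[|j]]]]]. Qed.

Definition sbg_vertices : seq sbg_vertex :=
  [:: P11; P61] ++ flatten
    [seq [seq t j | j <- residues5] | t <- [:: P3; P4; H2; H3; H4; H5]].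

Lemma mem_sbg_vertices (v : sbg_vertex) : v \in sbg_vertices.
Proof. by case: v => // -[[|[|[|[|[|j]]]]]]. Qed.

(** Replaces the quantifier over [j] in [sbg_adj] by a concrete list that evaluates. *)
Definition sbg_edge_list : seq (sbg_vertex * sbg_vertex) :=
  flatten [seq sbg_edges j | j <- residues5].

Lemma mem_sbg_edge_list (x y : sbg_vertex) :
  ((x, y) \in sbg_edge_list) = [exists j, (x, y) \in sbg_edges j].
Proof.
apply/flatten_mapP/existsP => [[j _ xy]|[j xy]]; exists j => //.
exact: mem_residues5.
Qed.

Lemma sbg_adjE (x y : sbg_vertex) :
  sbg_adj x y = ((x, y) \in sbg_edge_list) || ((y, x) \in sbg_edge_list).
Proof.
rewrite !mem_sbg_edge_list; apply/existsP/orP => [[j /orP[]]|[]/existsP[j]] xy.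
- by left; apply/existsP; exists j.
- by right; apply/existsP; exists j.
- by exists j; rewrite xy.
- by exists j; rewrite xy orbT.
Qed.

Definition edge_ball (T : eqType) (es : seq (T * T)) (v : T) : seq T :=
  v :: [seq e.2 | e <- es & e.1 == v] ++ [seq e.1 | e <- es & e.2 == v].

Lemma mem_edge_ball (T : eqType) (es : seq (T * T)) (v w : T) :
  (w \in edge_ball es v) = [|| w == v, (v, w) \in es | (w, v) \in es].
Proof.
rewrite inE mem_cat; congr (_ || (_ || _)).
  apply/mapP/idP => [[[x y]]|vw]; last by exists (v, w); rewrite ?mem_filter ?eqxx.
  by rewrite mem_filter => /andP[/eqP /= -> xy] ->.
apply/mapP/idP => [[[x y]]|wv]; last by exists (w, v); rewrite ?mem_filter ?eqxx.
by rewrite mem_filter => /andP[/eqP /= -> xy] ->.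
Qed.

Definition sbg_ball : sbg_vertex -> seq sbg_vertex := edge_ball sbg_edge_list.

Lemma mem_sbg_ball (v w : SBG) : (w \in sbg_ball v) = (w \in cl_nbhd v).
Proof. by rewrite mem_edge_ball -sbg_adjE in_setU1 in_set. Qed.

Definition symdiff (T : eqType) (c d : seq T) : seq T :=
  [seq x <- c | x \notin d] ++ [seq x <- d | x \notin c].

(** Balls have 6 or 7 elements, and adjacent faces have exactly two common neighbours, so each
    symmetric difference taken here has only 5 or 6 elements. *)
Definition sbg_constraints : seq (seq sbg_vertex) :=
  [seq sbg_ball v | v <- sbg_vertices] ++
  [seq symdiff (sbg_ball e.1) (sbg_ball e.2) | e <- sbg_edge_list].

Lemma hits_symdiff (T : finType) (c d : seq T) (A B S : {set T}) :
  c =i A -> d =i B -> A :&: S != B :&: S -> has (mem (enum S)) (symdiff c d).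
Proof.
move=> cA dB AB; apply/hasP; move: AB.
rewrite eqEsubset negb_and => /orP[] /subsetPn[x];
  rewrite !inE => /andP[xc xS]; rewrite xS andbT => xd;
  exists x; rewrite /= ?mem_enum //;
  by rewrite mem_cat !mem_filter cA dB xc xd ?orbT.
Qed.

Lemma ICS_hits (S : {set SBG}) : is_ICS S -> hits (enum S) sbg_constraints.
Proof.
case=> dom sep; rewrite /hits all_cat !all_map; apply/andP; split.
  apply/allP => v _; have /set0Pn[w] := dom v.
  rewrite in_setI => /andP[vw wS]; apply/hasP.
  by exists w; [rewrite mem_sbg_ball | rewrite inE mem_enum].
apply/allP => -[v w] vw; apply: (hits_symdiff (mem_sbg_ball v) (mem_sbg_ball w)).
(* The ends of an edge are distinct, as the graph has no loops. *)
apply: sep; apply: contraTneq vw => ->; have := sbg_adj_irrefl w.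
by rewrite sbg_adjE orbb => ->.
Qed.

(** Numbering the vertices lets the search compare natural numbers instead of constructors carrying
    residues. *)
Definition sbg_index (v : sbg_vertex) : nat := index v sbg_vertices.

Lemma no_hitting_sbg : no_hitting 9 (map (map sbg_index) sbg_constraints).
Proof. by vm_compute. Qed.

Lemma ICS_card_ge10 (S : {set SBG}) : is_ICS S -> 10 <= #|S|.
Proof.
move=> /ICS_hits/(hits_map sbg_index)/(no_hitting_size no_hitting_sbg).
by rewrite size_map -cardE.
Qed.

(** For the whole vertex set, separation amounts to the absence of twins, a finite check. This
    yields some identifying code, hence a minimum one. *)
Lemma sbg_ball_neq :
  all (fun v => all (fun w => (v == w) ||
    (symdiff (sbg_ball v) (sbg_ball w) != [::])) sbg_vertices) sbg_vertices.
Proof. by vm_compute. Qed.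

Lemma symdiff_neq (T : finType) (c d : seq T) (A B : {set T}) :
  c =i A -> d =i B -> symdiff c d != [::] -> A != B.
Proof.
move=> cA dB; apply: contraNneq => AB; apply/eqP.
by rewrite /symdiff !(@eq_in_filter _ _ pred0) ?filter_pred0 // => x;
  rewrite cA dB AB => ->.
Qed.

Lemma ICS_setT : is_ICS [set: SBG].
Proof.
split=> [v|v w vNw]; rewrite !setIT.
  by apply/set0Pn; exists v; rewrite in_setU1 eqxx.
apply: (symdiff_neq (mem_sbg_ball v) (mem_sbg_ball w)).
have /allP/(_ _ (mem_sbg_vertices w)) := allP sbg_ball_neq _ (mem_sbg_vertices v).
by case/orP => // vw; case/negP: vNw.
Qed.

Lemma exists_MICS (G : sgraph) (S0 : {set G}) :
  is_ICS S0 -> exists S : {set G}, is_MICS S.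
Proof.
(* A boolean form of [is_ICS], over which a set of least cardinality can be selected. *)
pose ics (S : {set G}) := [forall v, cl_nbhd v :&: S != set0] &&
  [forall v, forall w, (v != w) ==> (cl_nbhd v :&: S != cl_nbhd w :&: S)].
have icsP S : reflect (is_ICS S) (ics S).
  apply: (iffP andP) => -[dom sep]; split.
  - exact/forallP.
  - by move=> v w; move/forallP/(_ v)/forallP/(_ w)/implyP: sep.
  - exact/forallP.
  - by apply/forallP => v; apply/forallP => w; apply/implyP/sep.
move=> /icsP S0ics.
case: (arg_minnP (fun S : {set G} => #|S|) S0ics) => S /icsP Sics Smin.
by exists S; split=> // S' /icsP; apply: Smin.
Qed.

Theorem theorem4 :
  (exists S : {set SBG}, is_MICS S) /\
  (forall S : {set SBG}, is_MICS S -> 10 <= #|S|).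
Proof.
split; first exact: exists_MICS ICS_setT.
by move=> S [/ICS_card_ge10].
Qed.
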